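(* Let $F$ be an algebraically closed field, let $A$ be a symmetric $F$-algebra and let $I$ be an ideal of $A$ for which $\bar{A} := A/I$ is symmetric. Let $\nu\colon A\to\bar{A}$, $a\mapsto a+I$, be the canonical projection. (i) If $J(Z(A))$ is an ideal of $A$, then $J(Z(\bar{A}))$ is an ideal of $\bar{A}$. (ii) If $\operatorname{soc}(Z(A))$ is an ideal of $A$, then $\operatorname{Ann}_{Z(\bar{A})}(\nu(J(Z(A))))$ and $\operatorname{soc}(Z(\bar{A}))$ are ideals of $\bar{A}$.
   Context: All $F$-algebras are finite-dimensional, associative and unitary. ''Ideal'' means two-sided ideal. $Z(\cdot)$ is the center, $J(\cdot)$ the Jacobson radical, $\operatorname{soc}(\cdot)$ the (left) socle, i.e. the sum of all simple left ideals. $\operatorname{Ann}_{Z(\bar A)}(S)$ denotes the annihilator of $S$ in $Z(\bar A)$, i.e. $\{x\in Z(\bar A) : xs=0 \text{ for all } s\in S\}$. An $F$-algebra $A$ is symmetric if it admits a non-degenerate, associative (i.e. $\beta(ab,c)=\beta(a,bc)$), symmetric bilinear form $\beta\colon A\times A\to F$. *)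

(* Defs.v *)
From HB Require Import structures.
From mathcomp Require Import all_boot all_order all_algebra.

Set Implicit Arguments.
Unset Strict Implicit.
Unset Printing Implicit Defensive.

Import GRing.Theory.
Local Open Scope ring_scope.
Local Open Scope quotient_scope.

(* Finite-dimensional associative unitary F-algebras. The zero algebra is      *)
(* allowed, so that A / I makes sense for I = A; algType and falgType exclude  *)
(* it, and Hierarchy Builder accepts no new join of PzRing and Lmodule. Hence  *)
(* the product is part of the mixin, and the PzRing structure is derived.      *)
HB.mixin Record Vector_isFdAlgebra (F : fieldType) A of Vector F A := {
  fdalg_one : A;
  fdalg_mul : A -> A -> A;
  fdalg_mulA : associative fdalg_mul;
  fdalg_mul1l : left_id fdalg_one fdalg_mul;
  fdalg_mul1r : right_id fdalg_one fdalg_mul;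
  fdalg_mulDl : left_distributive fdalg_mul +%R;
  fdalg_mulDr : right_distributive fdalg_mul +%R;
  fdalg_mulZl : forall (k : F) (x y : A),
    k *: fdalg_mul x y = fdalg_mul (k *: x) y;
  fdalg_mulZr : forall (k : F) (x y : A),
    k *: fdalg_mul x y = fdalg_mul x (k *: y)
}.

#[short(type="fdalgType")]
HB.structure Definition FdAlgebra (F : fieldType) :=
  { A of Vector_isFdAlgebra F A & Vector F A }.

HB.instance Definition _ (F : fieldType) (A : fdalgType F) :=
  GRing.Zmodule_isPzRing.Build A
    fdalg_mulA fdalg_mul1l fdalg_mul1r fdalg_mulDl fdalg_mulDr.

Lemma fdalg_scalerAl (F : fieldType) (A : fdalgType F) (k : F) (x y : A) :
  k *: (x * y) = (k *: x) * y.
Proof. exact: fdalg_mulZl. Qed.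

Lemma fdalg_scalerAr (F : fieldType) (A : fdalgType F) (k : F) (x y : A) :
  k *: (x * y) = x * (k *: y).
Proof. exact: fdalg_mulZr. Qed.

Section Algebra.
Variables (F : fieldType) (A : fdalgType F).

Definition symmetric_algebra : Prop :=
  exists beta : {biscalar A},
    [/\ forall a b c, beta (a * b) c = beta a (b * c),
        forall a b, beta a b = beta b a
      & forall a, (forall b, beta a b = 0) -> a = 0].

Definition is_ideal (P : A -> Prop) : Prop :=
  [/\ P 0,
      forall x y, P x -> P y -> P (x - y),
      forall a x, P x -> P (a * x)
    & forall a x, P x -> P (x * a)].

(* Every ideal is a subspace, since k *: x = (k *: 1) * x. *)
Record ideal := Ideal {
  ideal_space :> {vspace A};
  idealP : is_ideal (fun x => x \in ideal_space)
}.

Definition commutator_with (a : A) : A -> A := fun x => x * a - a * x.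

Definition center : {vspace A} :=
  (\bigcap_(i < \dim {:A}) lker (linfun (commutator_with (vbasis {:A})`_i)))%VS.

(* Below, S stands for a unitary subalgebra of A; its left ideals are then     *)
(* subspaces of A.                                                             *)
Section Subalgebra.
Variable S : {vspace A}.

Definition left_ideal (L : {vspace A}) : Prop :=
  (L <= S)%VS /\ forall a x, a \in S -> x \in L -> a * x \in L.

Definition maximal_left_ideal (M : {vspace A}) : Prop :=
  [/\ left_ideal M, M <> S
    & forall L, left_ideal L -> (M <= L)%VS -> L = M \/ L = S].

Definition simple_left_ideal (L : {vspace A}) : Prop :=
  [/\ left_ideal L, L <> 0%VS
    & forall L', left_ideal L' -> (L' <= L)%VS -> L' = 0%VS \/ L' = L].

Definition jacobson (x : A) : Prop :=
  x \in S /\ forall M, maximal_left_ideal M -> x \in M.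

Definition socle (x : A) : Prop :=
  exists2 Ls : seq {vspace A},
    forall L, L \in Ls -> simple_left_ideal L & x \in (\sum_(L <- Ls) L)%VS.

Definition annihilator (T : A -> Prop) (x : A) : Prop :=
  x \in S /\ forall t, T t -> x * t = 0.

End Subalgebra.

Fact commutator_with_is_linear a : linear (commutator_with a).
Proof.
move=> k x y; rewrite /commutator_with mulrDl mulrDr -fdalg_scalerAl.
by rewrite -fdalg_scalerAr opprD addrACA scalerBr.
Qed.
HB.instance Definition _ a :=
  GRing.isLinear.Build F A A _ (commutator_with a) (commutator_with_is_linear a).

Lemma centerP x : x \in center <-> forall a, x * a = a * x.
Proof.
have inK a : (x \in lker (linfun (commutator_with a))) = (x * a == a * x).
  by rewrite memv_ker lfunE /= /commutator_with subr_eq0.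
split=> [Zx a | Zx]; last first.
  by rewrite memvE; apply/subv_bigcapP => i _; rewrite -memvE inK Zx.
have Zb i : x * (vbasis {:A})`_i = (vbasis {:A})`_i * x.
  have [ltiA | leAi] := ltnP i (\dim {:A}); last first.
    by rewrite nth_default ?size_tuple // mulr0 mul0r.
  apply/eqP; rewrite -inK memvE.
  by move: Zx; rewrite memvE => /subv_bigcapP/(_ (Ordinal ltiA) isT).
rewrite (coord_vbasis (memvf a)) mulr_sumr mulr_suml.
by apply: eq_bigr => i _; rewrite -fdalg_scalerAr -fdalg_scalerAl Zb.
Qed.

Lemma center1 : 1 \in center.
Proof. by apply/centerP => a; rewrite mul1r mulr1. Qed.

Lemma centerM x y : x \in center -> y \in center -> x * y \in center.
Proof.
move=> /centerP Zx /centerP Zy; apply/centerP => a.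
by rewrite -mulrA Zy mulrA Zx -mulrA.
Qed.

End Algebra.

Definition image_of (T U : Type) (f : T -> U) (P : T -> Prop) : U -> Prop :=
  fun y => exists2 x, P x & f x = y.

(* The zmodType structure on {ideal_quot I} comes from ring_quotient, whose    *)
(* product is only available for proper ideals of commutative rings.           *)
Definition quot_algebra (F : fieldType) (A : fdalgType F) (I : ideal A) : Type :=
  {ideal_quot ideal_space I}.

Section Quotient.
Variables (F : fieldType) (A : fdalgType F) (I : ideal A).
Local Notation Q := (quot_algebra I).

HB.instance Definition _ := GRing.Zmodule.on Q.
HB.instance Definition _ := EqQuotient.on Q.

Definition quot_proj (a : A) : Q := \pi_Q a.

Lemma quot_projP a b : quot_proj a = quot_proj b <-> a - b \in I.
Proof. by rewrite Quotient.idealrBE; split=> [ab | /eqP ab]; first apply/eqP. Qed.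

Lemma quot_proj_surj (q : Q) : exists a, quot_proj a = q.
Proof. by exists (repr q); exact: reprK. Qed.

Lemma quot_reprP a : repr (quot_proj a) - a \in I.
Proof. by apply/quot_projP; exact: reprK. Qed.

Lemma quot_projD a b : quot_proj (a + b) = quot_proj a + quot_proj b.
Proof. exact: (raddfD (\pi_({ideal_quot ideal_space I}))). Qed.

Lemma quot_proj0 : quot_proj 0 = 0.
Proof. exact: (raddf0 (\pi_({ideal_quot ideal_space I}))). Qed.

Definition quot_scale (k : F) (x : Q) : Q := quot_proj (k *: repr x).
Definition quot_one : Q := quot_proj 1.
Definition quot_mul (x y : Q) : Q := quot_proj (repr x * repr y).

Lemma quot_projZ k a : quot_scale k (quot_proj a) = quot_proj (k *: a).
Proof. by apply/quot_projP; rewrite -scalerBr memvZ ?quot_reprP. Qed.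

Lemma quot_projM a b : quot_mul (quot_proj a) (quot_proj b) = quot_proj (a * b).
Proof.
apply/quot_projP; have [_ _ Il Ir] := idealP I.
set a' := repr _; set b' := repr _.
have -> : a' * b' - a * b = (a' - a) * b' + a * (b' - b).
  by rewrite mulrBl mulrBr addrA addrNK.
by apply: memvD; [apply: Ir | apply: Il]; exact: quot_reprP.
Qed.

Local Ltac lift x := case: (quot_proj_surj x) => {}x <-.

Fact quot_scaleA a b (x : Q) : quot_scale a (quot_scale b x) = quot_scale (a * b) x.
Proof. by lift x; rewrite !quot_projZ scalerA. Qed.
Fact quot_scale1 : left_id 1 quot_scale.
Proof. by move=> x; lift x; rewrite quot_projZ scale1r. Qed.
Fact quot_scaleDr : right_distributive quot_scale +%R.
Proof.
by move=> k x y; lift x; lift y; rewrite -quot_projD !quot_projZ -quot_projD scalerDr.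
Qed.
Fact quot_scaleDl (x : Q) : {morph quot_scale^~ x : a b / a + b}.
Proof. by move=> a b; lift x; rewrite !quot_projZ -quot_projD scalerDl. Qed.

HB.instance Definition _ := GRing.Zmodule_isLmodule.Build F Q
  quot_scaleA quot_scale1 quot_scaleDr quot_scaleDl.

Definition quot_coord (x : Q) : subvs_of I^C :=
  vsproj I^C (repr x - projv I (repr x)).

Lemma quot_coordE a : vsval (quot_coord (quot_proj a)) = a - projv I a.
Proof.
rewrite vsprojK ?memv_projC //; set b := repr _.
have /projv_id : b - a \in I by exact: quot_reprP.
rewrite linearB /= => /eqP; rewrite subr_eq => /eqP ->.
by rewrite opprD addrA subKr.
Qed.

Fact quot_coord_is_linear : linear quot_coord.
Proof.
move=> k x y; apply: val_inj; rewrite [in RHS]linearP.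
lift x; lift y; rewrite {1}/GRing.scale /= quot_projZ -quot_projD !quot_coordE.
by rewrite linearP scalerBr opprD addrACA.
Qed.

Fact quot_coord_bij : bijective quot_coord.
Proof.
exists (quot_proj \o vsval) => [x | w] /=.
  lift x; rewrite quot_coordE; apply/quot_projP.
  by rewrite addrAC subrr add0r memvN memv_proj.
apply: val_inj; rewrite /= quot_coordE.
have /eqP -> : projv I (vsval w) == 0 by rewrite -memv_ker lker_proj subvsP.
by rewrite subr0.
Qed.

Fact quot_vect_iso : Vector.axiom (\dim I^C) Q.
Proof.
have [f f_lin f_bij] := subvs_vect_iso I^C%VS.
exists (f \o quot_coord); last exact: bij_comp quot_coord_bij.
by move=> k x y; rewrite [LHS]/= quot_coord_is_linear f_lin.
Qed.
HB.instance Definition _ := Lmodule_hasFinDim.Build F Q quot_vect_iso.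

Fact quot_mulA : associative quot_mul.
Proof. by move=> x y z; lift x; lift y; lift z; rewrite !quot_projM mulrA. Qed.
Fact quot_mul1l : left_id quot_one quot_mul.
Proof. by move=> x; lift x; rewrite quot_projM mul1r. Qed.
Fact quot_mul1r : right_id quot_one quot_mul.
Proof. by move=> x; lift x; rewrite quot_projM mulr1. Qed.
Fact quot_mulDl : left_distributive quot_mul +%R.
Proof.
move=> x y z; lift x; lift y; lift z.
by rewrite -quot_projD !quot_projM -quot_projD mulrDl.
Qed.
Fact quot_mulDr : right_distributive quot_mul +%R.
Proof.
move=> x y z; lift x; lift y; lift z.
by rewrite -quot_projD !quot_projM -quot_projD mulrDr.
Qed.
Fact quot_mulZl (k : F) (x y : Q) : k *: quot_mul x y = quot_mul (k *: x) y.
Proof.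
lift x; lift y.
by rewrite /GRing.scale /= quot_projM !quot_projZ quot_projM fdalg_scalerAl.
Qed.
Fact quot_mulZr (k : F) (x y : Q) : k *: quot_mul x y = quot_mul x (k *: y).
Proof.
lift x; lift y.
by rewrite /GRing.scale /= quot_projM !quot_projZ quot_projM fdalg_scalerAr.
Qed.

HB.instance Definition _ := Vector_isFdAlgebra.Build F Q
  quot_mulA quot_mul1l quot_mul1r quot_mulDl quot_mulDr quot_mulZl quot_mulZr.
HB.instance Definition _ := GRing.PzRing.copy Q (Q : fdalgType F).

End Quotient.

(* Main.v *)
(* The form of A / I, pulled back to A, is beta(z, -) for a central z, so that
   I = Ann(z) and nu(a) |-> z a identifies Z(A / I) with a subspace of Z(A). For
   a subspace of the center that is J(Z) or an annihilator in Z, being an ideal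
   means killing all commutators. Since J(Z) consists of the nilpotent elements
   of Z and soc(Z) = Ann_Z(J(Z)), a |-> z a sends J(Z(A / I)) into J(Z(A)) and
   Ann(nu(J(Z(A)))) into soc(Z(A)), and z a [b, c] = 0 means
   nu(a) [nu(b), nu(c)] = 0. Finally nu(J(Z(A))) lies in J(Z(A / I)), hence
   soc(Z(A / I)) lies in Ann(nu(J(Z(A)))). *)
Require Import Defs.
From HB Require Import structures.
From mathcomp Require Import all_boot all_order all_algebra.
From Stdlib Require Import Classical.

Set Implicit Arguments.
Unset Strict Implicit.
Unset Printing Implicit Defensive.

Import GRing.Theory.
Local Open Scope ring_scope.

(** Serves to pass from the annihilator of the radical to the socle: the two predicates are
    equivalent, not convertible. *)
Lemma is_ideal_ext (F : fieldType) (A : fdalgType F) (P Q : A -> Prop) :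
  (forall x, P x <-> Q x) -> is_ideal P -> is_ideal Q.
Proof.
move=> PQ [P0 PB Pl Pr]; split; first exact/PQ.
- by move=> x y /PQ Px /PQ Py; apply/PQ/PB.
- by move=> a x /PQ Px; apply/PQ/Pl.
- by move=> a x /PQ Px; apply/PQ/Pr.
Qed.

(** * Radical and socle of a commutative subalgebra *)

Section CommutativeSubalgebra.
Variables (F : fieldType) (A : fdalgType F) (S : {vspace A}).
Hypotheses (S1 : 1 \in S) (SM : forall x y, x \in S -> y \in S -> x * y \in S).
Hypothesis SC : forall x y, x \in S -> y \in S -> x * y = y * x.

Definition mulr_by (x : A) : A -> A := fun y => y * x.

Fact mulr_by_is_linear x : linear (mulr_by x).
Proof. by move=> k y z; rewrite /mulr_by mulrDl -fdalg_scalerAl. Qed.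
HB.instance Definition _ x :=
  GRing.isLinear.Build F A A _ (mulr_by x) (mulr_by_is_linear x).

Definition principal (x : A) : {vspace A} := (linfun (mulr_by x) @: S)%VS.

Lemma principalP x y : reflect (exists2 s, s \in S & y = s * x) (y \in principal x).
Proof.
by apply: (iffP memv_imgP) => [] [s Ss ->]; exists s; rewrite ?lfunE.
Qed.

Lemma principal_id x : x \in principal x.
Proof. by apply/principalP; exists 1; rewrite ?mul1r. Qed.

Lemma principal_ideal x : x \in S -> left_ideal S (principal x).
Proof.
move=> Sx; split=> [|a _ Sa /principalP[s Ss ->]].
  by apply/subvP => _ /principalP[s Ss ->]; apply: SM.
by apply/principalP; exists (a * s); rewrite ?mulrA ?SM.
Qed.

Lemma principal_sub L x : left_ideal S L -> x \in L -> (principal x <= L)%VS.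
Proof. by move=> [_ SL] Lx; apply/subvP => _ /principalP[s Ss ->]; apply: SL. Qed.

Lemma subalgebraX x n : x \in S -> x ^+ n \in S.
Proof. by move=> Sx; elim: n => // n IHn; rewrite exprS SM. Qed.

Lemma left_idealD L M :
  left_ideal S L -> left_ideal S M -> left_ideal S (L + M)%VS.
Proof.
move=> [LS SL] [MS SMM]; split; first by rewrite subv_add LS.
move=> a _ Sa /memv_addP[x Lx [y My ->]]; rewrite mulrDr.
by apply: memv_add; [apply: SL | apply: SMM].
Qed.

(** The principal ideals [S b^n] form a descending chain; were every inclusion strict, the
    dimensions would decrease forever. *)
Lemma power_stable b : b \in S ->
  exists n, exists2 d, d \in S & b ^+ n = d * b ^+ n.+1.
Proof.
move=> Sb; have sub n : (principal (b ^+ n.+1) <= principal (b ^+ n))%VS.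
  apply: principal_sub; first exact/principal_ideal/subalgebraX.
  by apply/principalP; exists b; rewrite ?exprS.
have [n le_n] : exists n, (\dim (principal (b ^+ n)) <= \dim (principal (b ^+ n.+1)))%N.
  apply: NNPP => no; have lt n : (\dim (principal (b ^+ n.+1)) < \dim (principal (b ^+ n)))%N.
    by rewrite ltnNge; apply/negP => le; apply: no; exists n.
  have bound n : (n + \dim (principal (b ^+ n)) <= \dim (principal (b ^+ 0)))%N.
    elim: n => [|n]; first by rewrite add0n.
    by apply: leq_trans; rewrite addSn -addnS leq_add2l.
  have := leq_trans (leq_addr _ _) (bound (\dim (principal (b ^+ 0))).+1).
  by rewrite ltnn.
have /eqP eqP : (principal (b ^+ n.+1) == principal (b ^+ n))%VS.
  by rewrite eqEdim sub.
have := principal_id (b ^+ n); rewrite -eqP => /principalP[d Sd e].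
by exists n, d.
Qed.

(** Von Neumann regularity modulo nilpotents: the [d] of [power_stable] satisfies
    [b^n (1 - d b) = 0], while [b - d b b = b (1 - d b)]. *)
Lemma regular_mod_nil b : b \in S ->
  exists2 c, c \in S & exists n, (b - c * b * b) ^+ n = 0.
Proof.
move=> Sb; have [n [d Sd dE]] := power_stable Sb; exists d => //.
(* The exponent [n + 1] supplies a factor [1 - d b] even when [n = 0]. *)
exists n.+1; have -> : b - d * b * b = b * (1 - d * b).
  by rewrite mulrBr mulr1 (SC Sb) ?SM.
have cb : GRing.comm b (1 - d * b).
  by apply: SC => //; rewrite memvB ?SM.
rewrite exprMn_comm // exprSr -mulrA; set u := (1 - d * b) ^+ n.+1.
have Su : u \in S by rewrite subalgebraX // memvB ?SM.
have e : b ^+ n * (1 - d * b) = 0.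
  rewrite mulrBr mulr1 (SC (subalgebraX n Sb)) ?SM // -mulrA -exprS -dE subrr //.
by rewrite /u exprS [b * _]mulrA cb -!mulrA mulrA e mul0r.
Qed.

(** Induction on the codimension of [L] in [S]: a proper left ideal that is not maximal lies in a
    strictly larger proper one. *)
Lemma maximal_exists L : left_ideal S L -> 1 \notin L ->
  exists2 M, maximal_left_ideal S M & (L <= M)%VS.
Proof.
have [k] := ubnP (\dim S - \dim L); elim: k L => // k IHk L lek iL L1.
have [mL | nmL] := classic (maximal_left_ideal S L); first by exists L.
have [L' [iL' LL' nL nS]] : exists L', [/\ left_ideal S L', (L <= L')%VS, L' <> L & L' <> S].
  apply: NNPP => no; apply: nmL; split=> // [LS | L' iL' LL'].
    by move: L1; rewrite LS S1.
  apply: NNPP => no'; apply: no; exists L'.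
  by split=> // e; apply: no'; [left | right].
have L'S := iL'.1.
have ltL : (\dim L < \dim L')%N.
  rewrite ltnNge; apply/negP => le; apply: nL; apply/esym/eqP.
  by rewrite eqEdim LL'.
have L'1 : 1 \notin L'.
  apply/negP => L'1; apply: nS; apply: subv_anti; rewrite L'S.
  by apply/subvP => s Ss; rewrite -[s]mulr1 iL'.2.
have lek' : (\dim S - \dim L' < k)%N.
  rewrite ltnS in lek; apply: leq_trans lek.
  by apply: ltn_sub2l => //; apply: leq_trans ltL (dimvS L'S).
by have [M mM L'M] := IHk L' lek' iL' L'1; exists M => //; apply: subv_trans L'M.
Qed.

Lemma jacobsonP x : jacobson S x <-> x \in S /\ exists n, x ^+ n = 0.
Proof.
split=> [[Sx Jx] | [Sx [n xn0]]]; split=> //.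
  (* Here [(1 - d x) x^n = 0], so it suffices that [1 - d x] is a unit of [S]. Otherwise it lies in
     a maximal ideal, which also contains [x] and hence [1]. *)
  have [n [d Sd dE]] := power_stable Sx; exists n.
  have Su : 1 - d * x \in S by rewrite memvB ?SM.
  have [/principalP[s Ss s1] | no1] := boolP (1 \in principal (1 - d * x)).
    rewrite -[x ^+ n]mul1r s1 -mulrA mulrBl mul1r -mulrA -exprS -dE.
    by rewrite subrr mulr0.
  have [M mM sub] := maximal_exists (principal_ideal Su) no1.
  have [[MS SMM] nMS _] := mM; case: nMS; apply: subv_anti; rewrite MS.
  have M1 : 1 \in M.
    rewrite -[1](subrK (d * x)) memvD //; last by rewrite SMM ?Jx.
    by apply: subvP (principal_id _).
  by apply/subvP => s Ss; rewrite -[s]mulr1 SMM.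
(* If a maximal [M] misses the nilpotent [x], then [M + S x = S] and [1 = m + s x] with [m] in [M].
   So [M] contains [1 - (s x)^k] for all [k], and thus [1]. *)
move=> M [iM nMS maxM]; have [MS SMM] := iM.
have iN := left_idealD iM (principal_ideal Sx).
have [<- | NS] := maxM _ iN (addvSl _ _).
  exact: (subvP (addvSr _ _)) (principal_id x).
case: nMS; apply: subv_anti; rewrite MS.
have := S1; rewrite -{1}NS => /memv_addP[m Mm [_ /principalP[s Ss ->] e]].
have Sm : m \in S by apply: (subvP MS).
have MX k : 1 - (s * x) ^+ k \in M.
  elim: k => [|k IHk]; first by rewrite subrr mem0v.
  have -> : 1 - (s * x) ^+ k.+1 = (1 - (s * x) ^+ k) + (s * x) ^+ k * m.
    have -> : m = 1 - s * x by rewrite {1}e addrK.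
    by rewrite mulrBr mulr1 -exprSr addrA addrNK.
  by rewrite memvD // SMM // subalgebraX ?SM.
have M1 : 1 \in M.
  by have := MX n; rewrite exprMn_comm ?xn0 ?mulr0 ?subr0 //; apply: SC.
by apply/subvP => t St; rewrite -[t]mulr1 SMM.
Qed.

Lemma socleD x y : socle S x -> socle S y -> socle S (x + y).
Proof.
move=> [Ls sL Lx] [Ms sM My]; exists (Ls ++ Ms) => [L|].
  by rewrite mem_cat => /orP[/sL | /sM].
by rewrite big_cat memv_add.
Qed.

(** The subideal [L j] is [0] or [L]; in the latter case [L = L j^n = 0], because [j] is
    nilpotent. *)
Lemma simple_annihilator L j y : simple_left_ideal S L ->
  jacobson S j -> y \in L -> y * j = 0.
Proof.
move=> [iL _ sL] /jacobsonP[Sj [n jn0]] Ly; have [LS SL] := iL.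
have Sy z : z \in L -> z \in S by exact: (subvP LS).
set L' := (linfun (mulr_by j) @: L)%VS.
have L'P z : reflect (exists2 t, t \in L & z = t * j) (z \in L').
  by apply: (iffP memv_imgP) => [] [s Ls ->]; exists s; rewrite ?lfunE.
have L'L : (L' <= L)%VS.
  by apply/subvP => _ /L'P[t Lt ->]; rewrite (SC (Sy _ Lt) Sj) SL.
have iL' : left_ideal S L'.
  split; first exact: subv_trans LS.
  by move=> a _ Sa /L'P[t Lt ->]; apply/L'P; exists (a * t); rewrite ?mulrA ?SL.
have : y * j \in L' by apply/L'P; exists y.
have [-> | e] := sL _ iL' L'L; first by rewrite memv0 => /eqP.
move=> _; suff all k z : z \in L -> exists2 t, t \in L & z = t * j ^+ k.
  by have [t _ ->] := all n y Ly; rewrite jn0 mulr0 mul0r.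
elim: k z => [|k IHk] z Lz; first by exists z; rewrite ?mulr1.
have [t Lt ->] := IHk z Lz; move: Lt; rewrite -{1}e => /L'P[u Lu ->].
by exists u; rewrite // exprS mulrA.
Qed.

(* Any [b] in [S] is von Neumann regular modulo the radical, which kills [x].
   So a nonzero proper subideal of [S x], with nonzero element [b x], gives an
   [e = c b] acting on [S x] as an idempotent that is neither [0] nor [1], and
   both [e x] and [(1 - e) x] generate smaller ideals than [x]. *)
Lemma annihilator_socle x : annihilator S (jacobson S) x -> socle S x.
Proof.
have [k] := ubnP (\dim (principal x)).
elim: k x => // k IHk x; rewrite ltnS => lek [Sx xJ].
have iP := principal_ideal Sx.
have [sP | nsP] := classic (simple_left_ideal S (principal x)).
  exists [:: principal x] => [L|]; first by rewrite inE => /eqP ->.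
  by rewrite big_seq1 principal_id.
have [x0 | nx0] := eqVneq x 0.
  by exists [::] => //; rewrite big_nil x0 mem0v.
have [L [iL LP nL0 nLP]] : exists L,
    [/\ left_ideal S L, (L <= principal x)%VS, L <> 0%VS & L <> principal x].
  apply: NNPP => no; apply: nsP; split=> // [P0 | L iL LP].
    by move: nx0 (principal_id x); rewrite P0 memv0 => /negPf ->.
  apply: NNPP => no'; apply: no; exists L.
  by split=> // e; apply: no'; [left | right].
have smaller M : (M <= principal x)%VS -> M <> principal x -> (\dim M < k)%N.
  move=> MP nMP; apply: leq_trans lek; rewrite ltnNge; apply/negP => le.
  by apply: nMP; apply/eqP; rewrite eqEdim MP.
set y := vpick L; have Ly : y \in L by exact: memv_pick.
have ny0 : y != 0 by rewrite vpick0; apply/eqP.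
have [b Sb yE] := principalP _ _ (subvP LP _ Ly).
have [c Sc [n nil]] := regular_mod_nil Sb.
have Sr : b - c * b * b \in S by rewrite memvB ?SM.
have rx0 : (b - c * b * b) * x = 0.
  by rewrite SC // xJ //; apply/jacobsonP; split => //; exists n.
have ey : c * b * y = y.
  by apply/eqP; rewrite yE mulrA -subr_eq0 -opprB oppr_eq0 -mulrBl rx0.
have exL : c * b * x \in L by rewrite -mulrA -yE iL.2.
have ScS z : z \in S -> annihilator S (jacobson S) (z * x).
  by move=> Sz; split=> [|t Jt]; [apply: SM | rewrite -mulrA xJ ?mulr0].
rewrite -[x](addrNK (c * b * x)); apply: socleD; last first.
  apply: IHk; last by apply: ScS; apply: SM.
  apply: leq_ltn_trans (smaller L LP nLP); apply/dimvS.
  exact: principal_sub.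
have -> : x - c * b * x = (1 - c * b) * x by rewrite mulrBl mul1r.
have S1e : 1 - c * b \in S by rewrite memvB ?SM.
apply: IHk; last exact: ScS.
apply: smaller => [|e].
  by apply: principal_sub => //; apply/principalP; exists (1 - c * b).
(* With [e = c b]: if [(1 - e) x] generated [S x], then [y = s (1 - e) x] for some [s], so
   [y = e y = s e (1 - e) x = 0]. *)
have : y \in principal ((1 - c * b) * x) by rewrite e (subvP LP).
case/principalP => s Ss ys; case/eqP: ny0; rewrite -ey ys.
have cbx : c * b * ((1 - c * b) * x) = 0.
  have -> : c * b * ((1 - c * b) * x) = c * ((b - c * b * b) * x).
    by rewrite !mulrA !mulrBr mulr1 -!mulrA [b * (c * b)]mulrA (SC Sb Sc) !mulrA.
  by rewrite rx0 mulr0.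
by rewrite mulrA (SC (SM Sc Sb) Ss) -mulrA cbx mulr0.
Qed.

(** The radical kills each simple ideal, hence every finite sum of them; the converse is
    [annihilator_socle]. *)
Lemma socleP x : socle S x <-> annihilator S (jacobson S) x.
Proof.
split=> [[Ls sLs] | ]; last exact: annihilator_socle.
elim: Ls sLs x => [|L Ls IH] sLs x.
  by rewrite big_nil memv0 => /eqP ->; split=> [|t _]; rewrite ?mem0v ?mul0r.
rewrite big_cons => /memv_addP[y Ly [z Lz ->]].
have sL : simple_left_ideal S L by apply: sLs; rewrite mem_head.
have [M LsM | Sz zJ] := IH _ z Lz; first by apply: sLs; rewrite inE LsM orbT.
split=> [|t Jt]; last by rewrite mulrDl zJ // (simple_annihilator sL) // addr0.
by rewrite memvD //; case: sL => [[/subvP LS _] _ _]; apply: LS.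
Qed.

End CommutativeSubalgebra.

(** * Ideals of the algebra contained in its center *)

Section Center.
Variables (F : fieldType) (A : fdalgType F).
Local Notation Z := (center A).

Lemma center_commute (x y : A) : x \in Z -> y \in Z -> x * y = y * x.
Proof. by move=> /centerP Zx _. Qed.

Lemma jacobson_centerP (x : A) :
  jacobson Z x <-> x \in Z /\ exists n, x ^+ n = 0.
Proof. exact: jacobsonP (center1 A) (@centerM _ A) center_commute x. Qed.

Lemma socle_centerP (x : A) : socle Z x <-> annihilator Z (jacobson Z) x.
Proof. exact: socleP (center1 A) (@centerM _ A) center_commute x. Qed.

Definition kills_commutators (x : A) := forall a b, x * (a * b) = x * (b * a).

(** Both [x] and [x a] are central, so [x a b = b x a = x b a]. *)
Lemma central_ideal_kills_commutators (P : A -> Prop) :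
  is_ideal P -> (forall x, P x -> x \in Z) -> forall x, P x -> kills_commutators x.
Proof.
move=> [_ _ _ Pr] PZ x Px a b.
have /centerP Zxa := PZ _ (Pr a x Px); have /centerP Zx := PZ _ Px.
by rewrite mulrA Zxa !mulrA Zx.
Qed.

Lemma kills_commutators_central (x a : A) :
  x \in Z -> kills_commutators x -> x * a \in Z.
Proof. by move=> /centerP Zx xK; apply/centerP => b; rewrite -mulrA xK mulrA Zx mulrA. Qed.

(** Centrality of [t] gives [x a t = x t a = 0], and [x a] stays central because [x] kills
    commutators. *)
Lemma annihilator_ideal (T : A -> Prop) :
  (forall t, T t -> t \in Z) ->
  (forall x, annihilator Z T x -> kills_commutators x) ->
  is_ideal (annihilator Z T).
Proof.
move=> TZ Kx; have mr a x : annihilator Z T x -> annihilator Z T (x * a).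
  move=> [Zx xT]; split; first exact/kills_commutators_central/Kx.
  by move=> t Tt; have /centerP Zt := TZ t Tt; rewrite -mulrA -Zt mulrA xT // mul0r.
split=> // [| x y [Zx xT] [Zy yT] | a x Nx].
- by split=> [|t _]; rewrite ?mem0v ?mul0r.
- by split=> [|t Tt]; rewrite ?memvB // mulrBl xT // yT // subr0.
by have [/centerP <- _] := Nx; apply: mr.
Qed.

(** For central [x], [(x a)^n = x^n a^n], so nilpotency passes to [x a]. *)
Lemma jacobson_center_ideal :
  (forall x, jacobson Z x -> kills_commutators x) -> is_ideal (jacobson Z).
Proof.
move=> JK; have mr a x : jacobson Z x -> jacobson Z (x * a).
  move=> Jx; have /jacobson_centerP[Zx [n xn0]] := Jx; apply/jacobson_centerP.
  split; first exact/kills_commutators_central/JK.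
  have /centerP cx := Zx; exists n; rewrite exprMn_comm ?xn0 ?mul0r //; exact: cx.
split=> // [| x y [Zx Jx] [Zy Jy] | a x Jx].
- by split=> [|M _]; exact: mem0v.
- by split=> [|M mM]; apply: memvB => //; [apply: Jx | apply: Jy].
by have [/centerP <- _] := Jx; apply: mr.
Qed.

End Center.

(** * Representing linear forms by a nondegenerate bilinear form *)

Section Symmetric.
Variables (F : fieldType) (A : fdalgType F).

Definition form_row (beta : {biscalar A}) (z : A) : 'rV[F]_(\dim {:A}) :=
  \row_i beta z (vbasis {:A})`_i.

Fact form_row_is_linear beta : linear (form_row beta).
Proof. by move=> k x y; apply/rowP => i; rewrite !mxE linearPl. Qed.
HB.instance Definition _ beta :=
  GRing.isLinear.Build F A _ _ (form_row beta) (form_row_is_linear beta).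

(** Nondegeneracy makes [form_row beta] injective; its source and target have equal dimension, so it
    is onto. *)
Lemma nondegenerate_representable (beta : {biscalar A}) (mu : {scalar A}) :
  (forall a, (forall b, beta a b = 0) -> a = 0) ->
  exists z, forall a, beta z a = mu a.
Proof.
move=> nondeg.
have ker0 : lker (linfun (form_row beta)) = 0%VS.
  apply/eqP; rewrite -subv0; apply/subvP => z; rewrite memv_ker lfunE /= memv0.
  move=> /eqP/rowP hz0; apply/eqP/nondeg => b.
  rewrite (coord_vbasis (memvf b)) linear_sumr big1 // => i _.
  by have := hz0 i; rewrite !mxE linearZr_LR => ->; rewrite mulr0.
have im : limg (linfun (form_row beta)) = fullv.
  apply/eqP; rewrite eqEdim subvf /= limg_dim_eq ?ker0 ?capv0 //.
  by rewrite [X in (X <= _)%N]dimvf dim_matrix mul1r.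
have : \row_i mu (vbasis {:A})`_i \in limg (linfun (form_row beta)).
  by rewrite im memvf.
case/memv_imgP => z _ /rowP e; exists z => a.
rewrite (coord_vbasis (memvf a)) linear_sumr linear_sum.
apply: eq_bigr => i _; have := e i; rewrite lfunE !mxE linearZr_LR linearZ /=.
by move=> ->.
Qed.

End Symmetric.

(** * A central element whose annihilator is [I] *)

Section SymmetricQuotient.
Variables (F : fieldType) (A : fdalgType F) (I : ideal A).
Local Notation Abar := (quot_algebra I : fdalgType F).
Local Notation nu := (quot_proj I : A -> Abar).

Lemma quot_proj_mul (a b : A) : nu (a * b) = nu a * nu b.
Proof. by rewrite -[RHS]/(quot_mul _ _) quot_projM. Qed.

Lemma quot_proj_exp (a : A) n : nu (a ^+ n) = nu a ^+ n.
Proof. by elim: n => // n IHn; rewrite !exprS quot_proj_mul IHn. Qed.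

Lemma quot_proj_scale k (a : A) : nu (k *: a) = k *: nu a.
Proof. by rewrite -[RHS]/(quot_scale _ _) quot_projZ. Qed.

Lemma quot_projB (a b : A) : nu (a - b) = nu a - nu b.
Proof. by apply/(addIr (nu b)); rewrite addrNK -[LHS]quot_projD addrNK. Qed.

Section Form.
Variable beta : {biscalar Abar}.
(** For associative [beta], the value at [a * b] is [beta (nu a) (nu b)], so this linear form
    determines [beta]. *)
Definition pullback_form (a : A) : F := beta (nu a) 1.
Fact pullback_form_is_scalar : scalar pullback_form.
Proof. by move=> k x y; rewrite /pullback_form quot_projD quot_proj_scale linearPl. Qed.
HB.instance Definition _ :=
  GRing.isLinear.Build F A F *%R pullback_form pullback_form_is_scalar.
End Form.

Lemma symmetric_quotient_annihilator :
  symmetric_algebra A -> symmetric_algebra Abar ->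
  exists2 z, z \in center A & forall a, z * a = 0 <-> nu a = 0.
Proof.
move=> [beta [bA bC b0]] [gam [gA gC g0]].
have [z zE] := nondegenerate_representable (pullback_form gam) b0.
have gM a b : gam (nu a) (nu b) = beta z (a * b).
  by rewrite zE /= /pullback_form quot_proj_mul gA mulr1.
exists z => [|a].
  (* By symmetry of both forms, [z a] and [a z] each pair with [b] to [gam (nu a) (nu b)];
     nondegeneracy of [beta] makes them equal. *)
  apply/centerP => a; apply/eqP; rewrite -subr_eq0; apply/eqP/b0 => b.
  by rewrite linearBl /= bA -gM gC gM [beta (a * z) b]bC -(bA b) [beta _ z]bC subrr.
(* As [beta (z a) b = gam (nu a) (nu b)], one direction is nondegeneracy of [gam], the other that of
   [beta]. *)
split=> [za0 | a0].
  by apply: g0 => q; have [b <-] := quot_proj_surj q; rewrite gM -bA za0 linear0l.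
by apply: b0 => b; rewrite bA -gM a0 linear0l.
Qed.

End SymmetricQuotient.

(** * Transfer from [A] to [A / I] *)

Theorem proposition2p10 (F : closedFieldType) (A : fdalgType F) (I : ideal A)
    (symA : symmetric_algebra A)
    (symAI : symmetric_algebra (quot_algebra I)) :
  let Abar : fdalgType F := quot_algebra I in
  let nu : A -> Abar := quot_proj I in
  (is_ideal (jacobson (center A)) -> is_ideal (jacobson (center Abar)))
  /\
  (is_ideal (socle (center A)) ->
     is_ideal (annihilator (center Abar)
                 (image_of nu (jacobson (center A))))
     /\ is_ideal (socle (center Abar))).
Proof.
move=> Abar nu; have [z Zz zE] := symmetric_quotient_annihilator symA symAI.
have /centerP cz := Zz.
have liftZ a : nu a \in center Abar -> z * a \in center A.
  move=> /centerP Za; apply/centerP => b; apply/eqP.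
  (* [z] kills [a b - b a], so [z a b = z b a = b z a]. *)
  have /zE/eqP : nu (a * b - b * a) = 0 by rewrite /nu quot_projB !quot_proj_mul Za subrr.
  by rewrite mulrBr subr_eq0 !mulrA -cz.
have nuJ t : image_of nu (jacobson (center A)) t -> jacobson (center Abar) t.
  move=> [j /jacobson_centerP[/centerP Zj [n jn0]] <-]; apply/jacobson_centerP.
  split; last by exists n; rewrite /nu -quot_proj_exp jn0 quot_proj0.
  by apply/centerP => q; have [b <-] := quot_proj_surj q; rewrite /nu -!quot_proj_mul Zj.
have liftK a : kills_commutators (z * a) -> kills_commutators (nu a).
  move=> zaK p q; have [b <-] := quot_proj_surj p; have [c <-] := quot_proj_surj q.
  apply/eqP; rewrite /nu -subr_eq0 -!quot_proj_mul -quot_projB; apply/eqP/zE.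
  by rewrite mulrBr !mulrA -!mulrA !(mulrA z) zaK subrr.
split=> [idJ | idS].
  apply: jacobson_center_ideal => x; have [a <-] := quot_proj_surj x.
  move=> /jacobson_centerP[Za [n an0]]; apply: liftK.
  apply: (central_ideal_kills_commutators idJ) => [y [] // | ].
  apply/jacobson_centerP; split; first exact: liftZ.
  (* [(z a)^(n+1) = z^n (z a^n) a]; the extra factor [z] is what lets [z a^n = 0] apply even for
     [n = 0]. *)
  exists n.+1; rewrite exprMn_comm; last exact: cz.
  have /zE zan0 : nu (a ^+ n) = 0 by rewrite /nu quot_proj_exp.
  by rewrite exprSr -mulrA exprSr (mulrA z) zan0 mul0r mulr0.
have annK x : annihilator (center Abar) (image_of nu (jacobson (center A))) x ->
    kills_commutators x.
  have [a <-] := quot_proj_surj x; move=> [Za aJ]; apply: liftK.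
  apply: (central_ideal_kills_commutators idS) => [y /socle_centerP[] // | ].
  apply/socle_centerP; split=> [|j Jj]; first exact: liftZ.
  by rewrite -mulrA; apply/zE; rewrite /nu quot_proj_mul aJ //; exists j.
split; first by apply: annihilator_ideal => // t /nuJ[].
(* The socle is the annihilator of the radical of the center of [Abar]. That radical contains the
   image of the radical of [center A], so [annK] applies. *)
apply: (is_ideal_ext (fun x => iff_sym (socle_centerP x))).
apply: annihilator_ideal => [t [] // | x [Zx xJ]].
by apply: annK; split=> // t /nuJ; apply: xJ.
Qed.
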